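(* Let $X$ be a space and let $n$ be a positive integer. For a fixed $x_0\in X$, consider the inclusions $j_i: X^{n-1}\hookrightarrow X^n$ given by $$j_i(x_1,\dots,x_{n-1})=(x_1,\dots,x_{i-1},x_0,x_i,x_{i+1},\dots,x_{n-1})$$ for $i\in\{1,2,\dots,n\}$. Then $\mathrm{D}(j_1,\dots,j_n)=\mathrm{cat}(X^{n-1})$.
   Context: All maps are continuous. For maps $f_1,\dots,f_n:A\to B$, the $n$-th homotopic distance $\mathrm{D}(f_1,\dots,f_n)$ is the least non-negative integer $k$ such that there exist open subsets $U_0,U_1,\dots,U_k$ which cover $A$ and satisfy $f_1|_{U_j}\simeq f_2|_{U_j}\simeq\cdots\simeq f_n|_{U_j}$ (homotopic as maps $U_j\to B$) for all $j\in\{0,1,\dots,k\}$; if there is no such covering, $\mathrm{D}(f_1,\dots,f_n)=\infty$. The Lusternik-Schnirelmann category $\mathrm{cat}(A)$ of a space $A$ is the least integer $k\ge 0$ such that there exists an open covering $\{U_0,U_1,\dots,U_k\}$ of $A$ with the property that the inclusion $U_i\hookrightarrow A$ of each $U_i$ is null-homotopic (homotopic to a constant map).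
   Formalization: The space X is additionally assumed path-connected; without this the claim fails, e.g. for X a discrete two-point space and n = 2, where cat(X) = 1 but D(j_1, j_2) = ∞. *)

(* Defs.v *)
From HB Require Import structures.
From mathcomp Require Import all_boot all_order all_algebra.
From mathcomp Require Import all_classical all_reals all_analysis.
Set Implicit Arguments.
Unset Strict Implicit.
Unset Printing Implicit Defensive.
Import Order.TTheory GRing.Theory Num.Theory.
Import numFieldNormedType.Exports.
Local Open Scope classical_set_scope.
Local Open Scope ring_scope.

(* The homotopy is a total function on A * R of which only the restriction to
   U x [0,1], with the subspace topology, matters. *)
Definition homotopic_on (R : realType) (A B : topologicalType) (U : set A)
    (f g : A -> B) : Prop :=
  exists H : A * R -> B,
    [/\ {within U `*` `[0, 1], continuous H},
        forall a, U a -> H (a, 0) = f a &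
        forall a, U a -> H (a, 1) = g a].

Definition path_connected (R : realType) (X : topologicalType) : Prop :=
  forall x y : X, exists p : R -> X,
    [/\ {within `[0, 1], continuous p}, p 0 = x & p 1 = y].

(* Natural numbers extended with infinity: [None] stands for infinity, the
   value of the minimum when no natural number satisfies [P]. *)
Definition least_nat (P : set nat) : option nat :=
  match pselect (exists k, `[< P k >]) with
  | left exP => Some (ex_minn exP)
  | right _ => None
  end.

(* Normalized: the number is 0 when A itself satisfies [P]. *)
Definition open_cover_number (A : topologicalType) (P : set (set A)) :
    option nat :=
  least_nat [set k | exists U : 'I_k.+1 -> set A,
    [/\ forall j, open (U j), \bigcup_j U j = [set: A] & forall j, P (U j)]].

Definition homotopic_distance (R : realType) (A B : topologicalType) (n : nat)
    (f : 'I_n -> A -> B) : option nat :=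
  open_cover_number [set U | forall i k : 'I_n, k = i.+1 :> nat ->
    homotopic_on R U (f i) (f k)].

Definition LS_category (R : realType) (A : topologicalType) : option nat :=
  open_cover_number [set U | exists c : A, homotopic_on R U id (cst c)].

(* [unlift i k] is [None] at k = i, and otherwise the index of k among the
   coordinates other than i. *)
Definition insert_coord (X : topologicalType) (x0 : X) (n : nat) (i : 'I_n)
    (x : {ptws 'I_n.-1 -> X}) : {ptws 'I_n -> X} :=
  fun k => if unlift i k is Some l then x l else x0.

Lemma insert_coord_continuous (X : topologicalType) (x0 : X) (n : nat)
  (i : 'I_n) : continuous (insert_coord x0 i).
Proof.
move=> x; have F := fmap_filter (insert_coord x0 i) (nbhs_filter x).
apply/cvg_sup => k; apply/cvg_image.
  by rewrite eqEsubset; split=> // y _; exists (fun=> y).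
suff fc : continuous (fun y => insert_coord x0 i y k).
  move=> V /(fc x) nV; exists ((fun f : {ptws 'I_n -> X} => f k) @^-1` V) => //.
  rewrite eqEsubset; split=> y /=; first by case=> f + <-.
  by move=> Vy; exists (fun=> y).
rewrite /insert_coord; case: unliftP => [l _|_]; last exact: cst_continuous.
exact: (@proj_continuous _ (fun=> X) l).
Qed.

(* Main.v *)
(* Both numbers minimise over covers by open sets with a given property, and
   the two properties agree on every open [U].  If the inclusion of [U] is
   homotopic to a constant [c], then [j_i] is homotopic on [U] to the constant
   [j_i c], and any two constants are homotopic as [X] is path connected.
   Conversely, composing a homotopy from [j_l] to [j_(l+1)] on [U] with the
   [l]-th projection contracts the [l]-th coordinate of [U] to [x0]; together
   these contract the inclusion of [U] to the constant point [(x0, ..., x0)]. *)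
Require Import Defs.
From mathcomp Require Import all_boot all_order all_algebra.
From mathcomp Require Import all_classical all_reals all_analysis.
From mathcomp Require Import zify lra.
Set Implicit Arguments.
Unset Strict Implicit.
Unset Printing Implicit Defensive.
Import Order.TTheory GRing.Theory Num.Theory.
Import numFieldNormedType.Exports.
Local Open Scope classical_set_scope.
Local Open Scope ring_scope.

(** Membership in [A] becomes a premise under an ambient neighbourhood filter, so that continuity on
    different subsets can be compared at the same point. *)
Lemma within_continuousP (S T : topologicalType) (A : set S) (f : S -> T) :
  {within A, continuous f} <->
  (forall x, A x -> forall O, nbhs (f x) O ->
    \forall y \near x, A y -> O (f y)).
Proof. exact: subspace_continuousP. Qed.

Lemma within_continuous_comp (S T V : topologicalType) (A : set S) (B : set T)
    (f : S -> T) (g : T -> V) :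
  {homo f : x / A x >-> B x} -> {within A, continuous f} ->
  {within B, continuous g} -> {within A, continuous (g \o f)}.
Proof.
move=> AB /within_continuousP fc /within_continuousP gc.
apply/within_continuousP => x Ax O /(gc _ (AB _ Ax))/(fc x Ax).
by apply: filterS => y BO Ay; apply: BO => //; exact: AB.
Qed.

Lemma eq_within_continuous (S T : topologicalType) (A : set S) (f g : S -> T) :
  {in A, f =1 g} -> {within A, continuous f} -> {within A, continuous g}.
Proof. exact: subspace_eq_continuous. Qed.

(** The pasting lemma. At a point of a closed piece its own continuity applies; a point off the
    piece has a neighbourhood missing it, where nothing is to be checked. *)
Lemma within_continuous_paste (T V : topologicalType) (W C D : set T)
    (f : T -> V) :
  closed C -> closed D -> W `<=` C `|` D ->
  {within W `&` C, continuous f} -> {within W `&` D, continuous f} ->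
  {within W, continuous f}.
Proof.
move=> Ccl Dcl WCD fC fD; apply/within_continuousP => x Wx O Ofx.
have near_part (E : set T) : closed E -> {within W `&` E, continuous f} ->
    \forall y \near x, W y -> E y -> O (f y).
  move=> Ecl /within_continuousP fE; have [Ex|nEx] := pselect (E x).
    by have := fE x (conj Wx Ex) _ Ofx; apply: filterS => y h Wy Ey; apply: h.
  have : nbhs x (~` E).
    by apply: open_nbhs_nbhs; split=> //; exact: closed_openC.
  by apply: filterS => y nEy _ /nEy.
apply: filterS2 (near_part _ Ccl fC) (near_part _ Dcl fD) => y hC hD Wy.
by case: (WCD y Wy) => h; [exact: hC|exact: hD].
Qed.

Lemma within_continuous_ptws (T : topologicalType) (I : Type)
    (X : topologicalType) (W : set T) (f : T -> {ptws I -> X}) :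
  (forall i, {within W, continuous (fun t => f t i)}) ->
  {within W, continuous f}.
Proof.
move=> fc; apply/subspace_continuousP => x Wx.
(* The pointwise topology is the supremum of the topologies pulled back along evaluations; each
   evaluation is onto, as constant functions show. *)
apply/cvg_sup => i; apply/cvg_image.
  by rewrite eqEsubset; split=> // y _; exists (fun=> y).
have /subspace_continuousP/(_ x Wx) fci := fc i.
move=> O /fci nO; exists ((fun g : {ptws I -> X} => g i) @^-1` O) => //.
rewrite eqEsubset; split=> y /=; first by case=> g + <-.
by move=> Oy; exists (fun=> y).
Qed.

Section Homotopy.
Variable R : realType.

(** Serves both to reverse a homotopy and to speed up the two halves of a concatenation, where [W]
    is only a half of the cylinder. *)
Lemma reparametrize_within_continuous (A B : topologicalType) (U : set A)
    (W : set (A * R)) (phi : R -> R) (H : A * R -> B) :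
  continuous phi -> W `<=` [set z | U z.1 /\ 0 <= phi z.2 <= 1] ->
  {within U `*` `[0, 1], continuous H} ->
  {within W, continuous (fun z => H (z.1, phi z.2))}.
Proof.
move=> phic WU Hc.
apply: (@within_continuous_comp _ _ _ _ _ (fun z => (z.1, phi z.2))) Hc.
  by move=> [a t] /WU[Ua phit]; split=> //=; rewrite in_itv.
apply: continuous_subspaceT => -[a t].
apply: (@cvg_pair _ _ _ _ (nbhs a) (nbhs (phi t))); first exact: cvg_fst.
by apply: (@cvg_comp _ _ _ snd phi); [exact: cvg_snd|exact: phic].
Qed.

Lemma homotopic_on_sym (A B : topologicalType) (U : set A) (f g : A -> B) :
  homotopic_on R U f g -> homotopic_on R U g f.
Proof.
case=> H [Hc H0 H1]; exists (fun z => H (z.1, 1 - z.2)); split.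
- apply: (reparametrize_within_continuous (phi := fun t => 1 - t)) Hc.
    by move=> t; apply: cvgB; [exact: cvg_cst|exact: cvg_id].
  by move=> [a t] /= [Ua]; rewrite /= in_itv /= => t01; split=> //; lra.
- by move=> a Ua /=; rewrite subr0 H1.
- by move=> a Ua /=; rewrite subrr H0.
Qed.

Lemma homotopic_on_trans (A B : topologicalType) (U : set A) (f g h : A -> B) :
  homotopic_on R U f g -> homotopic_on R U g h -> homotopic_on R U f h.
Proof.
move=> [H [Hc H0 H1]] [K [Kc K0 K1]].
pose L (z : A * R) := if z.2 <= 2^-1 then H (z.1, 2 * z.2)
                      else K (z.1, 2 * z.2 - 1).
have snd_continuous : continuous (snd : A * R -> R) by move=> z; exact: cvg_snd.
have double_continuous : continuous (fun t : R => 2 * t).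
  exact: mulrl_continuous.
exists L; split.
- apply: (@within_continuous_paste _ _ _ (snd @^-1` [set t : R | t <= 2^-1])
    (snd @^-1` [set t : R | 2^-1 <= t])).
  + by apply: preimage_closed => //; exact: closed_le.
  + by apply: preimage_closed => //; exact: closed_ge.
  + by move=> [a t] _ /=; case: (leP t 2^-1) => h2; [left|right; exact: ltW].
  + apply: (@eq_within_continuous (A * R)%type _ _
      (fun z => H (z.1, 2 * z.2))).
      by move=> [a t]; rewrite inE /L /= => -[_ ->].
    apply: reparametrize_within_continuous Hc => //.
    move=> [a t] /= [[Ua]]; rewrite /= in_itv /= => t01 th; split=> //; lra.
  + apply: (@eq_within_continuous (A * R)%type _ _
      (fun z => K (z.1, 2 * z.2 - 1))).
      (* At [t = 2^-1] the map [L] still follows [H]; there [H (a, 1) = g a = K (a, 0)]. *)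
      move=> [a t]; rewrite inE /L /= => -[[/= Ua _] th].
      case: ifPn => // th'.
      have -> : t = 2^-1 by apply/eqP; rewrite eq_le th'.
      by rewrite divff ?pnatr_eq0// subrr K0// H1.
    apply: (reparametrize_within_continuous (phi := fun t => 2 * t - 1)) Kc.
      by move=> t; apply: cvgB; [exact: double_continuous|exact: cvg_cst].
    move=> [a t] /= [[Ua]]; rewrite /= in_itv /= => t01 th; split=> //; lra.
- by move=> a Ua; rewrite /L /= invr_ge0 ler0n mulr0 H0.
- move=> a Ua; rewrite /L /= ifF; last by lra.
  by rewrite mulr1 (_ : 2 - 1 = 1 :> R) ?K1//; lra.
Qed.

Lemma homotopic_on_comp (A B C : topologicalType) (U : set A) (f g : A -> B)
    (h : B -> C) :
  continuous h -> homotopic_on R U f g -> homotopic_on R U (h \o f) (h \o g).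
Proof.
move=> hc [H [Hc H0 H1]]; exists (h \o H); split.
- apply: (@within_continuous_comp _ _ _ _ setT) => //.
  exact: continuous_subspaceT.
- by move=> a Ua /=; rewrite H0.
- by move=> a Ua /=; rewrite H1.
Qed.

(** Homotopies chosen for each coordinate assemble into one, by the universal property of the
    product. *)
Lemma homotopic_on_ptws (A X : topologicalType) (I : Type) (U : set A)
    (f g : A -> {ptws I -> X}) :
  (forall i, homotopic_on R U (fun a => f a i) (fun a => g a i)) ->
  homotopic_on R U f g.
Proof.
move=> /choice[H Hfg]; exists (fun z i => H i z); split.
- by apply: within_continuous_ptws => i; have [] := Hfg i.
- by move=> a Ua; apply/funext => i; have [_ ->] := Hfg i.
- by move=> a Ua; apply/funext => i; have [_ _ ->] := Hfg i.
Qed.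

Lemma homotopic_on_cst (A X : topologicalType) (U : set A) (x y : X) :
  path_connected R X -> homotopic_on R U (cst x) (cst y).
Proof.
move=> /(_ x y)[p [pc p0 p1]]; exists (p \o snd); split=> //=.
apply: within_continuous_comp pc; first by move=> [a t] [].
by apply: continuous_subspaceT => z; exact: cvg_snd.
Qed.

Lemma homotopic_insert_coord (X : topologicalType) (x0 : X) (m : nat)
    (U : set {ptws 'I_m -> X}) :
  path_connected R X ->
  (forall i k : 'I_m.+1, k = i.+1 :> nat ->
    homotopic_on R U (insert_coord x0 i) (insert_coord x0 k)) <->
  (exists c, homotopic_on R U id (cst c)).
Proof.
move=> X_pc; split=> [Uj|[c Uc] i k _].
  exists (fun=> x0); apply: homotopic_on_ptws => l.
  (* Coordinate [l] is contracted using the inclusions of indices [l] and [l + 1], encoded as [i]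
     and [lift ord0 l]. *)
  apply: homotopic_on_sym; pose i := widen_ord (leqnSn m) l.
  have pr_continuous : continuous (fun y : {ptws 'I_m.+1 -> X} => y i).
    exact: (@proj_continuous _ (fun=> X) i).
  have := homotopic_on_comp pr_continuous (Uj i (lift ord0 l) erefl).
  (* At place [l], the first inclusion has [x0]; the second inserts [x0] just after it, leaving
     [x l] there unshifted. *)
  congr homotopic_on; apply/funext => x /=; rewrite /insert_coord.
    by rewrite unlift_none.
  case: unliftP => [l' il'|/(congr1 val)/=]; last by rewrite /bump; lia.
  congr (x _); apply: val_inj; move/(congr1 val): il' => /=.
  by rewrite /bump /=; lia.
have j_cst i' := homotopic_on_comp (@insert_coord_continuous X x0 m.+1 i') Uc.
apply: homotopic_on_trans (j_cst i) _.
apply: homotopic_on_trans _ (homotopic_on_sym (j_cst k)).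
(* The two constant points are joined coordinate by coordinate, so paths in [X] suffice. *)
apply: homotopic_on_ptws => l.
exact: (homotopic_on_cst U (insert_coord x0 i c l) (insert_coord x0 k c l)).
Qed.

End Homotopy.

Theorem theorem3p4 (R : realType) (X : topologicalType)
    (X_pc : path_connected R X) (x0 : X) (n : nat) (n_gt0 : (0 < n)%N) :
  homotopic_distance R (fun i : 'I_n => insert_coord x0 i) =
  LS_category R {ptws 'I_n.-1 -> X}.
Proof.
(* With [n = m.+1], the exponent [n.-1] computes to [m], and it remains to equate the two properties
   of [U]. *)
case: n n_gt0 => // m _; congr open_cover_number.
by apply/predeqP => U; exact: homotopic_insert_coord.
Qed.
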